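(* Let $M$ be an $n$-dimensional differentiable manifold and $A:\mathfrak{X}(M)\to\mathfrak{X}(M)$ a nilcyclic $(1,1)$ tensor on $M$. If there exists a local chart $(U,x^1,\dots,x^n)$ in which $A$ takes the triangular form $$A=\sum_{i,j=1}^n a^i_j(x)\,\frac{\partial}{\partial x^i}\otimes dx^j,\qquad a^i_j=0\ \text{ if } i\ge j,$$ with $a^i_j$ smooth functions, then for every integer $k\ge2$ the generalized Nijenhuis torsion of level $k-1$ vanishes (on $U$) on $\ker A^k$: $$\tau^{(k-1)}_A(X,Y)=0\qquad\text{for all }X,Y\in\ker A^k.$$
   Context: $\mathfrak{X}(M)$ denotes the smooth vector fields on $M$, $[\cdot,\cdot]$ the Lie bracket; operators are smooth $(1,1)$ tensor fields. $A$ is nilcyclic if it is nilpotent of maximal index $n$: $A^n=0$ and $A^{n-1}\neq0$, so that there exist local reference frames (possibly non-integrable) in which $A$ is represented by a single strictly upper triangular Jordan block, and $\operatorname{rank}(\ker A^j)=j$ for $j=1,\dots,n$. Generalized Nijenhuis torsions: $\tau^{(0)}_A(X,Y):=[X,Y]$ and, for $m\ge1$, $$\tau^{(m)}_A(X,Y):=A^2\tau^{(m-1)}_A(X,Y)+\tau^{(m-1)}_A(AX,AY)-A\big(\tau^{(m-1)}_A(X,AY)+\tau^{(m-1)}_A(AX,Y)\big).$$ *)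

(* Defs.v *)
From HB Require Import structures.
From mathcomp Require Import all_boot all_order all_algebra.
From mathcomp Require Import all_classical all_reals all_analysis.
Import Order.TTheory GRing.Theory Num.Theory.
Import numFieldNormedType.Exports.

Set Implicit Arguments.
Unset Strict Implicit.
Unset Printing Implicit Defensive.

Local Open Scope classical_set_scope.
Local Open Scope ring_scope.

Section Smooth.
Context {R : realType} {E V : normedModType R}.

Definition iter_derive (s : seq E) (f : E -> V) : E -> V :=
  foldr (fun v g => fun x => 'D_v g x) f s.

(* [differentiable] is Frechet differentiability.  When [E] is finite
   dimensional and [O] is open (the only case used below), asking it of every
   iterated directional derivative is the same as asking [f] to be C^oo on
   [O]. *)
Definition smooth_on (O : set E) (f : E -> V) : Prop :=
  forall s x, O x -> differentiable (iter_derive s f) x.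

End Smooth.

(* Coordinates are column vectors, so that a (1,1) tensor with components
   a^i_j (upper index = row, lower index = column) acts by [*m]. *)
Record chart (R : realType) (T : topologicalType) (n : nat) := Chart {
  cdom : set T;
  cmap : T -> 'cV[R]_n;
  cinv : 'cV[R]_n -> T;
  cdom_open : open cdom;
  cimg_open : open (cmap @` cdom);
  cmapK : forall p, cdom p -> cinv (cmap p) = p;
  cmap_continuous : forall p, cdom p -> {for p, continuous cmap};
  cinv_continuous : forall x, (cmap @` cdom) x -> {for x, continuous cinv}
}.

Section Transition.
Context {R : realType} {T : topologicalType} {n : nat}.
Implicit Types c : chart R T n.

Definition transition c c' : 'cV[R]_n -> 'cV[R]_n := cmap c' \o cinv c.

Definition compatible c c' : Prop :=
  smooth_on (cmap c @` (cdom c `&` cdom c')) (transition c c') /\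
  smooth_on (cmap c' @` (cdom c' `&` cdom c)) (transition c' c).

End Transition.

Record manifold (R : realType) (n : nat) := Manifold {
  mspace :> topologicalType;
  mhausdorff : hausdorff_space mspace;
  msecond_countable : @second_countable mspace;
  atlas : set (chart R mspace n);
  atlas_cover : forall p : mspace, exists2 c, atlas c & cdom c p;
  atlas_compatible : forall c c', atlas c -> atlas c' -> compatible c c';
  atlas_maximal : forall c,
    (forall c', atlas c' -> compatible c c') -> atlas c
}.

Arguments atlas {R n} m _ : rename.

Section Fields.
Context {R : realType} {n : nat} {M : manifold R n}.

(* [Z c p] is the column of components at [p], relative to the coordinate
   frame of [c], of a vector field; it is meaningful only if [atlas M c] and
   [cdom c p].  Being a field of tangent vectors is the transformation law
   required in [vfield]. *)
Definition components := chart R M n -> M -> 'cV[R]_n.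

Record vfield (W : set M) := VField {
  vcomp :> components;
  vfield_smooth : forall c, atlas M c ->
    smooth_on (cmap c @` (cdom c `&` W)) (vcomp c \o cinv c);
  vfield_change : forall c c' p, atlas M c -> atlas M c' ->
    cdom c p -> cdom c' p -> W p ->
    vcomp c' p = 'd (transition c c') (cmap c p) (vcomp c p)
}.

Record tensor11 := Tensor11 {
  tcomp :> chart R M n -> M -> 'M[R]_n;
  tensor11_smooth : forall c, atlas M c ->
    smooth_on (cmap c @` cdom c) (tcomp c \o cinv c);
  tensor11_change : forall c c' p (v : 'cV[R]_n), atlas M c -> atlas M c' ->
    cdom c p -> cdom c' p ->
    tcomp c' p *m 'd (transition c c') (cmap c p) v
      = 'd (transition c c') (cmap c p) (tcomp c p *m v)
}.

Definition tapply (A : tensor11) (X : components) : components :=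
  fun c p => A c p *m X c p.

Definition vanishes_at (Z : components) (p : M) : Prop :=
  forall c, atlas M c -> cdom c p -> Z c p = 0.

Definition in_ker_pow (A : tensor11) (k : nat) (W : set M) (X : components)
    : Prop :=
  forall p, W p -> vanishes_at (iter k (tapply A) X) p.

(* [X, Y]^i = X^j d_j Y^i - Y^j d_j X^i in every chart. *)
Definition lie_bracket (X Y : components) : components := fun c p =>
  'D_(X c p) (Y c \o cinv c) (cmap c p) - 'D_(Y c p) (X c \o cinv c) (cmap c p).

Fixpoint torsion (A : tensor11) (m : nat) (X Y : components) : components :=
  if m is m'.+1 then fun c p =>
    A c p *m (A c p *m torsion A m' X Y c p)
    + torsion A m' (tapply A X) (tapply A Y) c p
    - A c p *m (torsion A m' X (tapply A Y) c p
                + torsion A m' (tapply A X) Y c p)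
  else lie_bracket X Y.

(* Maximal nilpotency index at every point, which is what makes ker A^j a
   distribution of rank j. *)
Definition nilcyclic (A : tensor11) : Prop :=
  forall c p, atlas M c -> cdom c p ->
    A c p ^+ n = 0 /\ A c p ^+ n.-1 <> 0.

Definition triangular_in (A : tensor11) (c : chart R M n) : Prop :=
  forall p, cdom c p -> forall i j : 'I_n, (j <= i)%N -> A c p i j = 0.

End Fields.

Arguments tensor11 {R n} M.
Arguments vfield {R n} M W.

(* Main.v *)
Require Import Defs.
From mathcomp Require Import all_boot all_order all_algebra.
From mathcomp Require Import all_classical all_reals all_analysis.
From mathcomp Require Import zify ring.
Import Order.TTheory GRing.Theory Num.Theory.
Import numFieldNormedType.Exports.
Local Open Scope classical_set_scope.
Local Open Scope ring_scope.

Set Implicit Arguments.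
Unset Strict Implicit.
Unset Printing Implicit Defensive.

(** In a chart where [A] is strictly upper triangular, nilcyclicity forces the
entries just above the diagonal to be nonzero, so that the kernel of [A ^+ k] is
the span V_k of the first [k] coordinate vectors ([ker_pow_in_flag]). Let N_u be
the derivative of the matrix of [A] along [u]; like [A], it maps V_j into
V_(j - 1).

The Leibniz rule gives the Nijenhuis torsion as P_0(u) v - P_0(v) u, with
P_0(u) = N_(Au) - A N_u, a formula without derivatives of the two fields. The
recursion preserves this shape: the torsion of level m + 1 is
P_m(u) v - P_m(v) u, where P_(m+1)(u) = A [A, P_m(u)] - [A, P_m(Au)]
([torsion_mxP]). By induction, up to a matrix that maps V_(m+2) to 0, P_m(u) is
(-1)^m times the m-fold commutator of [A] with N_w, where w = A^(m+1) u
([torsion_mx_mod]).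

For level k - 1 = m + 1 and u, v in V_k, with k <= n, the vector A^(k-1) u only
depends on the last coordinate of u, being that coordinate times a fixed
multiple of the first basis vector; and the m-fold commutator lowers the flag
by k - 1, so its value at v only depends on the last coordinate of v. Thus
P_m(u) v is the product u_k v_k times a fixed vector. This is symmetric in u
and v, and the torsion vanishes ([torsion_mx_sym]). If k > n, the m-fold
commutator lowers the flag by at least n, so it is zero.

The torsion is defined separately in each chart, and the argument above works
in the triangular chart only. It remains to see that its components transform
like those of a vector field ([torsion_change]). This reduces to the Lie
bracket, where it is the symmetry of the second derivatives of the transition
map ([schwarz]). *)

(** * Matrices that lower the standard flag *)

Section Flag.
Context {R : fieldType} {n : nat}.
Implicit Types (A B C : 'M[R]_n) (u v : 'cV[R]_n).

(** With [in_flag k] standing for membership in V_k, the span of the first [k]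
basis vectors, [lowers r B] is the entrywise form of: [B] maps each V_k into
V_(k - r). It makes the condition linear in [B]. *)
Definition lowers (r : nat) B := forall i j : 'I_n, (j < i + r)%N -> B i j = 0.
Definition in_flag (k : nat) v := forall i : 'I_n, (k <= i)%N -> v i 0 = 0.

Lemma lowersW r s B : (s <= r)%N -> lowers r B -> lowers s B.
Proof. by move=> sr Br i j /leq_trans ji; apply/Br/ji; rewrite leq_add2l. Qed.

Lemma lowersD r B C : lowers r B -> lowers r C -> lowers r (B + C).
Proof. by move=> Br Cr i j ij; rewrite mxE Br // Cr // addr0. Qed.

Lemma lowersN r B : lowers r B -> lowers r (- B).
Proof. by move=> Br i j ij; rewrite mxE Br // oppr0. Qed.

Lemma lowersB r B C : lowers r B -> lowers r C -> lowers r (B - C).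
Proof. by move=> Br Cr; apply/lowersD/lowersN. Qed.

Lemma lowersM r s B C : lowers r B -> lowers s C -> lowers (r + s) (B *m C).
Proof.
move=> Br Cs i j ij; rewrite mxE big1 // => l _.
have [li|il] := ltnP l (i + r); first by rewrite Br // mul0r.
rewrite Cs ?mulr0 //; apply: (leq_trans ij).
by rewrite addnA leq_add2r.
Qed.

Lemma lowersX r A : lowers 1 A -> lowers r (A ^+ r).
Proof.
move=> A1; elim: r => [|r IH]; last by rewrite exprS; exact: (lowersM A1 IH).
move=> i j; rewrite addn0 expr0 mxE => ij.
by case: eqP ij => // ->; rewrite ltnn.
Qed.

Lemma in_flag_mulmx r k B v :
  lowers r B -> in_flag k v -> in_flag (k - r) (B *m v).
Proof.
move=> Br vk i ki; rewrite mxE big1 // => j _.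
have [ji|ij] := ltnP j (i + r); first by rewrite Br // mul0r.
by rewrite vk ?mulr0 //; apply: leq_trans ij; rewrite addnC -leq_subLR.
Qed.

Lemma mulmx_flag0 r B v : lowers r B -> in_flag r v -> B *m v = 0.
Proof.
move=> Br vr; have := in_flag_mulmx Br vr; rewrite subnn => Bv0.
by apply/colP => i; rewrite Bv0 // mxE.
Qed.

(** On V_(r + 1) a matrix that lowers by [r] only sees the class modulo V_r,
which is a single coordinate. This is the one-dimensionality of the quotients
of the flag, and the reason why [torsion_mx] turns out symmetric. *)
Lemma mulmx_flag_top r B v (lt_rn : (r < n)%N) : lowers r B -> in_flag r.+1 v ->
  B *m v = v (Ordinal lt_rn) 0 *: col (Ordinal lt_rn) B.
Proof.
move=> Br vr; apply/colP => i; rewrite !mxE (bigD1 (Ordinal lt_rn)) //=.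
rewrite big1 ?addr0 1?mulrC //.
move=> j; rewrite -val_eqE /= neq_ltn => /orP[jr|rj]; last by rewrite vr ?mulr0.
by rewrite Br ?mul0r // (leq_trans jr) // leq_addl.
Qed.

(** If the entry (i, i + 1) of [A] vanished, [A] would map V_(i + 2) into V_i
instead of V_(i + 1); a product of n - 1 factors [A] would then gain one step
and send V_n to V_0 = 0. *)
Lemma superdiag_neq0 A (i j : 'I_n) : lowers 1 A -> A ^+ n.-1 <> 0 ->
  j = i.+1 :> nat -> A i j != 0.
Proof.
move=> A1 + ij; apply: contra_notN => Aij0.
have flagT (v : 'cV[R]_n) : in_flag n v by move=> l; rewrite leqNgt ltn_ord.
(* The one step at which [A] lowers the flag by two. *)
have skip v : in_flag j.+1 v -> in_flag i (A *m v).
  move=> vj l; rewrite leq_eqVlt => /orP[/eqP il|il].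
    rewrite mxE big1 // => h _.
    have [hj|jh] := ltnP j h; first by rewrite vj ?mulr0.
    have [->|hj] := eqVneq h j.
      by rewrite (_ : l = i) ?(eqP Aij0) ?mul0r //; apply/val_inj.
    by rewrite A1 ?mul0r // addn1 -il -ij ltn_neqAle jh andbT.
  have:= in_flag_mulmx A1 vj; rewrite subn1 /= => -> //.
  by rewrite ij.
have n_eq : n.-1 = (i + (1 + (n - j.+1)))%N.
  by rewrite addnA addn1 -ij -[in LHS](subnKC (ltn_ord j)).
apply/matrixP => a b; rewrite [RHS]mxE.
suff : A ^+ n.-1 *m delta_mx b (0 : 'I_1) = 0.
  by rewrite -colE => /colP/(_ a); rewrite !mxE.
rewrite n_eq !exprD expr1 -!mulmxE -!mulmxA.
apply: (mulmx_flag0 (lowersX (r := i) A1)); apply: skip.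
have := in_flag_mulmx (lowersX (r := n - j.+1) A1) (flagT (delta_mx b 0)).
by rewrite subKn.
Qed.

(** By induction on [k] it suffices that A v in V_k forces v in V_(k + 1). The
row j - 1 of [A *m v] is a nonzero multiple of [v j 0] plus terms in the later
entries of [v], so these entries vanish one after the other from the last. *)
Lemma ker_pow_in_flag A k v : lowers 1 A -> A ^+ n.-1 <> 0 ->
  A ^+ k *m v = 0 -> in_flag k v.
Proof.
move=> A1 An0; elim: k v => [v|k IH v].
  by rewrite expr0 mul1mx => -> i _; rewrite mxE.
rewrite exprSr -mulmxE -mulmxA => /IH Avk.
suff up d (j : 'I_n) : (n - d <= j)%N -> (k < j)%N -> v j 0 = 0.
  by move=> j; apply: (up n); rewrite subnn.
elim: d j => [|d IHd] j; first by rewrite subn0 leqNgt ltn_ord.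
move=> dj kj; have j0 : (0 < j)%N by apply: leq_ltn_trans kj.
have lt_jn : (j.-1 < n)%N by rewrite (leq_ltn_trans (leq_pred j)).
have := Avk (Ordinal lt_jn); rewrite /= -ltnS prednK // => /(_ kj).
rewrite mxE (bigD1 j) //= big1 => [|l].
  move/eqP; rewrite addr0 mulf_eq0 (negPf (superdiag_neq0 A1 An0 _)) ?prednK //.
  by move/eqP.
rewrite -val_eqE /= neq_ltn => /orP[lj|jl].
  by rewrite A1 ?mul0r //= addn1 prednK.
rewrite IHd ?mulr0 //; last exact: ltn_trans jl.
by lia.
Qed.

Definition commutator_mx A B := A *m B - B *m A.

Lemma lowers_commutator_mx r A B :
  lowers 1 A -> lowers r B -> lowers r.+1 (commutator_mx A B).
Proof.
move=> A1 Br; apply: lowersB; first exact: (lowersM A1 Br).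
by rewrite -addn1; exact: lowersM.
Qed.

Lemma lowers_iter_commutator_mx m r A B : lowers 1 A -> lowers r B ->
  lowers (m + r) (iter m (commutator_mx A) B).
Proof. by move=> A1 Br; elim: m => //= m; exact: lowers_commutator_mx. Qed.

Lemma commutator_mxB A B C :
  commutator_mx A (B - C) = commutator_mx A B - commutator_mx A C.
Proof.
rewrite /commutator_mx mulmxBr mulmxBl !opprB addrACA.
by rewrite [RHS]addrACA [- _ + _]addrC.
Qed.

(** The generalized torsions of a vector field bracket are tensors from level 1
on. When [N u] is the derivative of [A] along [u], the torsion of level m + 1
is [torsion_mx A N m u *m v - torsion_mx A N m v *m u]: level 1 is the usual
formula for the Nijenhuis torsion, and the recursion on torsions becomes the
one below. *)
Fixpoint torsion_mx (A : 'M[R]_n) (N : 'cV[R]_n -> 'M[R]_n) (m : nat) :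
    'cV[R]_n -> 'M[R]_n :=
  if m is m'.+1 then fun u =>
    A *m commutator_mx A (torsion_mx A N m' u)
    - commutator_mx A (torsion_mx A N m' (A *m u))
  else fun u => N (A *m u) - A *m N u.

(** Each step of the recursion produces two terms. In the first one the
commutator and the factor [A] lower the flag twice, so it disappears modulo
[lowers m.+3]; hence only the second one accumulates. *)
Lemma torsion_mx_mod A N m u : lowers 1 A -> (forall u, lowers 1 (N u)) ->
  lowers m.+2 (torsion_mx A N m u
    - (-1) ^+ m *: iter m (commutator_mx A) (N (A ^+ m.+1 *m u))).
Proof.
move=> A1 N1; elim: m u => [|m IH] u.
  rewrite expr0 scale1r expr1 /= addrAC subrr add0r.
  exact/lowersN/(lowersM A1 (N1 _)).
(* Both terms of the congruence lower by m + 1, hence so does [torsion_mx]. *)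
have P1 w : lowers m.+1 (torsion_mx A N m w).
  pose K := iter m (commutator_mx A) (N (A ^+ m.+1 *m w)).
  rewrite -[torsion_mx A N m w](subrK ((-1) ^+ m *: K)).
  apply: lowersD; first exact: lowersW (IH w).
  have := lowers_iter_commutator_mx (m := m) A1 (N1 (A ^+ m.+1 *m w)).
  rewrite addn1 -/K.
  by move=> L i j ij; rewrite mxE L ?mulr0.
have AdZ (a : R) B : a *: commutator_mx A B = commutator_mx A (a *: B).
  by rewrite /commutator_mx scalerBr -!scalemxAr -!scalemxAl.
rewrite [torsion_mx _ _ _ _]/= [iter _ _ _]/= exprS mulN1r scaleNr opprK AdZ.
rewrite -addrA; apply: lowersD.
  exact: (lowersM A1 (lowers_commutator_mx A1 (P1 u))).
rewrite addrC -opprB -commutator_mxB.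
apply/lowersN/lowers_commutator_mx => //; have := IH (A *m u).
by rewrite mulmxA mulmxE -exprSr.
Qed.

(** By [torsion_mx_mod] the left side only involves [A ^+ m.+1 *m u] and [v]
through matrices that lower by m + 1, and on V_(m + 2) these depend on one
coordinate of each. So both sides are the product of the last coordinates of
[u] and [v] with the same vector. If m + 1 >= n the matrices themselves are
zero. *)
Lemma torsion_mx_sym A N m u v : lowers 1 A -> (forall u, lowers 1 (N u)) ->
  (forall a u, N (a *: u) = a *: N u) ->
  in_flag m.+2 u -> in_flag m.+2 v ->
  torsion_mx A N m u *m v = torsion_mx A N m v *m u.
Proof.
move=> A1 N1 NZ um vm.
pose K w := iter m (commutator_mx A) (N w).
have Kl w : lowers m.+1 (K w).
  by rewrite /K -addn1; apply: lowers_iter_commutator_mx.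
have KZ a w : K (a *: w) = a *: K w.
  rewrite /K NZ; elim: m {um vm K Kl} => //= m ->.
  by rewrite /commutator_mx scalerBr -!scalemxAr -!scalemxAl.
have E w x : in_flag m.+2 x ->
    torsion_mx A N m w *m x = (-1) ^+ m *: (K (A ^+ m.+1 *m w) *m x).
  move=> xm; have := mulmx_flag0 (@torsion_mx_mod A N m w A1 N1) xm.
  by rewrite mulmxBl -scalemxAl => /eqP; rewrite subr_eq0 => /eqP.
rewrite !E //; congr (_ *: _).
have [lt_mn|le_nm] := ltnP m.+1 n; last first.
  have K0 w : K w = 0.
    apply/matrixP => i j; rewrite Kl ?mxE //.
    by rewrite (leq_trans (ltn_ord j)) // (leq_trans le_nm) // leq_addl.
  by rewrite !K0 !mul0mx.
have Am := lowersX (r := m.+1) A1.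
rewrite (mulmx_flag_top lt_mn Am um) (mulmx_flag_top lt_mn Am vm).
rewrite !KZ -!scalemxAl.
rewrite (mulmx_flag_top lt_mn (Kl _) um) (mulmx_flag_top lt_mn (Kl _) vm).
by rewrite !scalerA mulrC.
Qed.

End Flag.

Section TorsionStep.
Context {R : fieldType} {n : nat}.
Implicit Types (a P Q : 'M[R]_n) (x y s t : 'cV[R]_n).

(** The torsion of level 1 at a point, after the Leibniz rule: [s] and [t] stand
for the derivatives of Y along X and of X along Y, [s'] for that of Y along AX
and [t'] for that of X along AY; [P], [Q], [P'], [Q'] are the derivatives of the
tensor along X, Y, AX, AY. All derivatives of X and Y cancel. *)
Lemma nijenhuis_leibniz a P Q P' Q' x y s t s' t' :
  a *m (a *m (s - t)) + ((P' *m y + a *m s') - (Q' *m x + a *m t'))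
   - a *m (((P *m y + a *m s) - t') + (s' - (Q *m x + a *m t)))
  = (P' - a *m P) *m y - (Q' - a *m Q) *m x.
Proof.
rewrite !(mulmxDr, mulmxDl, mulmxN, mulNmx, mulmxA).
move: (a *m a *m s) (a *m a *m t) (P' *m y) (a *m s') (Q' *m x) (a *m t')
  (a *m P *m y) (a *m Q *m x) => *.
by apply/colP => i; rewrite !mxE; ring.
Qed.

(** The recursion of the torsions applied to a skew-symmetrized form; [P], [P']
are the matrices attached to X and AX, and [Q], [Q'] those for Y and AY. *)
Lemma torsion_mx_step a P Q P' Q' x y :
  a *m (a *m (P *m y - Q *m x)) + (P' *m (a *m y) - Q' *m (a *m x))
    - a *m ((P *m (a *m y) - Q' *m x) + (P' *m y - Q *m (a *m x)))
  = (a *m commutator_mx a P - commutator_mx a P') *m y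
    - (a *m commutator_mx a Q - commutator_mx a Q') *m x.
Proof.
rewrite /commutator_mx !(mulmxDr, mulmxDl, mulmxN, mulNmx, mulmxA).
move: (a *m a *m P *m y) (a *m a *m Q *m x) (P' *m a *m y) (Q' *m a *m x)
  (a *m P *m a *m y) (a *m Q' *m x) (a *m P' *m y) (a *m Q *m a *m x) => *.
by apply/colP => i; rewrite !mxE; ring.
Qed.
End TorsionStep.

(** * Symmetry of second derivatives *)

Section Schwarz.
Context {R : realType} {E : normedModType R}.

Lemma is_derive_line (f : E -> R) (x u : E) (s a : R) :
  is_derive (x + s *: u) u f a -> is_derive s 1 (fun t : R => f (x + t *: u)) a.
Proof.
have q : (fun h : R => h^-1 *: (f (x + (h *: 1 + s) *: u) - f (x + s *: u))) =
         (fun h : R => h^-1 *: (f (h *: u + (x + s *: u)) - f (x + s *: u))).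
  apply/funext => h; do 3 f_equal.
  by rewrite scalerDl addrCA -scalerA scale1r.
case=> d1 d2; split; first by rewrite /derivable /= /shift /= q; exact: d1.
by rewrite /derive /= /shift /= q; exact: d2.
Qed.

Lemma MVT_line (f df : E -> R) (x u : E) (s : R) : 0 < s ->
  (forall t, 0 <= t <= s -> is_derive (x + t *: u) u f (df (x + t *: u))) ->
  exists2 t, 0 <= t <= s & f (x + s *: u) - f x = s * df (x + t *: u).
Proof.
move=> s0 fd.
have fd1 t : 0 <= t <= s ->
    is_derive t 1 (fun t : R => f (x + t *: u)) (df (x + t *: u)).
  by move=> /fd; exact: is_derive_line.
have [] := @MVT R (fun t => f (x + t *: u)) (fun t => df (x + t *: u)) 0 s s0.
- by move=> t; rewrite in_itv /= => /andP[t0 ts]; apply: fd1; rewrite !ltW.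
- apply: derivable_within_continuous => t; rewrite in_itv /= => ts.
  by have [] := fd1 t ts.
move=> t; rewrite in_itv /= => /andP[t0 ts]; rewrite scale0r addr0 subr0 => ->.
by exists t; [rewrite !ltW | rewrite mulrC].
Qed.

(** The mean value theorem, applied to the increment of [f] along [v] as a
function along [u] and then to [fu] along [v]. *)
Lemma second_difference_MVT (f fu fuv : E -> R) (x u v : E) (s : R) : 0 < s ->
  (forall a b : R, 0 <= a <= s -> 0 <= b <= s ->
    is_derive (x + a *: u + b *: v) u f (fu (x + a *: u + b *: v)) /\
    is_derive (x + a *: u + b *: v) v fu (fuv (x + a *: u + b *: v))) ->
  exists a b, [/\ 0 <= a <= s, 0 <= b <= s &
    f (x + s *: u + s *: v) - f (x + s *: u) - (f (x + s *: v) - f x)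
    = s * s * fuv (x + a *: u + b *: v)].
Proof.
move=> s0 H.
have H0 (a : R) : 0 <= a <= s -> is_derive (x + a *: u) u f (fu (x + a *: u)).
  move=> ha; have [] := H a 0 ha; first by rewrite lexx ltW.
  by rewrite scale0r addr0.
have Hs (a : R) : 0 <= a <= s ->
    is_derive (x + a *: u) u (fun y => f (y + s *: v))
      (fu (x + a *: u + s *: v)).
  move=> ha; have [] := H a s ha; first by rewrite lexx ltW.
  case=> d1 d2 _; split.
    by move: d1; rewrite /derivable /= /shift /=; under eq_fun do rewrite addrA.
  by move: d2; rewrite /derive /= /shift /=; under eq_fun do rewrite addrA.
have [a ha Ea] := @MVT_line (fun y => f (y + s *: v) - f y)
  (fun y => fu (y + s *: v) - fu y) x u s s0
  (fun t ht => is_deriveB (Hs t ht) (H0 t ht)).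
have [b hb Eb] := @MVT_line fu fuv (x + a *: u) v s s0
  (fun t ht => (H a t ha ht).2).
by exists a, b; split; rewrite // -mulrA -Eb -Ea.
Qed.

(** The second difference of [f] on a small parallelogram is symmetric in [u]
and [v]. It equals [s * s] times a value of either mixed derivative near [x],
and these values tend to the ones at [x] by continuity. *)
Lemma schwarz (f fu fv fuv fvu : E -> R) (x u v : E) :
  (\forall y \near x, is_derive y u f (fu y)) ->
  (\forall y \near x, is_derive y v f (fv y)) ->
  (\forall y \near x, is_derive y v fu (fuv y)) ->
  (\forall y \near x, is_derive y u fv (fvu y)) ->
  {for x, continuous fuv} -> {for x, continuous fvu} -> fuv x = fvu x.
Proof.
move=> nu nv nuv nvu cuv cvu; apply/eqP.
rewrite -subr_eq0 -normr_eq0 -[_ == 0]negbK.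
apply/negP => d0; set d := `|fuv x - fvu x| in d0.
have {d0}d0 : 0 < d / 2 by rewrite divr_gt0 // lt_def d0 normr_ge0.
have /cvgrPdist_lt/(_ _ d0) nuv' := cuv.
have /cvgrPdist_lt/(_ _ d0) nvu' := cvu.
have /nbhs_ballP[e /= e0 ball_e] : \forall y \near x,
    [/\ is_derive y u f (fu y), is_derive y v f (fv y),
        is_derive y v fu (fuv y) & is_derive y u fv (fvu y)] /\
    `|fuv x - fuv y| < d / 2 /\ `|fvu x - fvu y| < d / 2.
  by near=> y; split; [split|split]; near: y.
(* This size keeps the whole parallelogram inside the ball. *)
pose s := e / (`|u| + `|v| + 1).
have D0 : 0 < `|u| + `|v| + 1 by rewrite ltr_wpDl // addr_ge0.
have s0 : 0 < s by rewrite divr_gt0.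
have inball (a b : R) (w z : E) : `|w| + `|z| = `|u| + `|v| ->
    0 <= a <= s -> 0 <= b <= s -> ball x e (x + a *: w + b *: z).
  move=> wz /andP[a0 as_] /andP[b0 bs].
  rewrite -ball_normE /ball_ /= -addrA opprD addNKr normrN.
  apply: le_lt_trans (ler_normD _ _) _; rewrite !normrZ !ger0_norm //.
  apply: (@le_lt_trans _ _ (s * (`|u| + `|v|))).
    by rewrite -wz mulrDr lerD // ler_wpM2r.
  by rewrite -[ltRHS](divfK (lt0r_neq0 D0)) -/s ltr_pM2l // ltrDl.
have [|a [b [ha hb E1]]] := @second_difference_MVT f fu fuv x u v s s0.
  by move=> a b ha hb; have [[? ? ? ?] _] :=
    ball_e _ (inball a b u v erefl ha hb).
have [|a' [b' [ha' hb' E2]]] := @second_difference_MVT f fv fvu x v u s s0.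
  by move=> a' b' ha' hb'; have [[? ? ? ?] _] :=
    ball_e _ (inball a' b' v u (addrC _ _) ha' hb').
have [_ [B1 _]] := ball_e _ (inball a b u v erefl ha hb).
have [_ [_ B2]] := ball_e _ (inball a' b' v u (addrC _ _) ha' hb').
have E3 : fuv (x + a *: u + b *: v) = fvu (x + a' *: v + b' *: u).
  apply: (@mulfI _ (s * s)); first by rewrite mulf_neq0 // gt_eqF.
  rewrite -E1 -E2 (addrAC x (s *: v)) !opprB.
  by ring.
have : d < d.
  rewrite [X in _ < X](splitr d); apply: le_lt_trans (ltrD B1 B2).
  by rewrite E3 [X in _ + X]distrC /d; apply: ler_distD.
by rewrite ltxx.
Unshelve. all: by end_near. Qed.

End Schwarz.

(** * Derivatives of matrix-valued functions *)

Section MatrixCalculus.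
Context {R : realType} {E : normedModType R}.

Lemma is_derive_coord m n (F : E -> 'M[R]_(m, n)) x v i j :
  derivable F x v -> is_derive x v (fun y => F y i j) ('D_v F x i j).
Proof.
move=> dF; have /derivable_mxP/(_ i j) dFij := dF.
by rewrite derive_mx // mxE; exact: derivableP.
Qed.

Lemma differentiable_entry m n (F : E -> 'M[R]_(m, n)) x i j :
  differentiable F x -> differentiable (fun y => F y i j) x.
Proof.
by move=> dF; exact: (differentiable_comp dF (differentiable_coord (F x) i j)).
Qed.

Lemma differentiable_mx m n (F : E -> 'M[R]_(m, n)) x :
  (forall i j, differentiable (fun y => F y i j) x) -> differentiable F x.
Proof.
move=> dF.
have -> : F = \sum_i \sum_j (fun y => F y i j *: delta_mx i j).
  apply/funext => y; rewrite fct_sumE [LHS]matrix_sum_delta.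
  by apply: eq_bigr => i _; rewrite fct_sumE.
apply: differentiable_sum => i; apply: differentiable_sum => j.
exact: differentiableZl.
Qed.

Lemma differentiable_mulmx m n p
    (F : E -> 'M[R]_(m, n)) (G : E -> 'M[R]_(n, p)) x :
  differentiable F x -> differentiable G x ->
  differentiable (fun y => F y *m G y) x.
Proof.
move=> dF dG; apply: differentiable_mx => i j.
have -> : (fun y => (F y *m G y) i j) =
          \sum_l ((fun y => F y i l) * (fun y => G y l j)).
  by apply/funext => y; rewrite fct_sumE mxE.
apply: differentiable_sum => l.
by apply: differentiableM; exact: differentiable_entry.
Qed.

Lemma is_derive_mulmx m n p
    (F : E -> 'M[R]_(m, n)) (G : E -> 'M[R]_(n, p)) x v :
  derivable F x v -> derivable G x v ->
  is_derive x v (fun y => F y *m G y) ('D_v F x *m G x + F x *m 'D_v G x).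
Proof.
move=> dF dG.
have H i j : is_derive x v (fun y => (F y *m G y) i j)
    (('D_v F x *m G x + F x *m 'D_v G x) i j).
  have -> : (fun y => (F y *m G y) i j) =
            \sum_l ((fun y => F y i l) * (fun y => G y l j)).
    by apply/funext => y; rewrite fct_sumE mxE.
  rewrite !mxE -big_split /=; apply: is_derive_sum => l.
  apply: is_derive_eq.
    exact: is_deriveM (is_derive_coord i l dF) (is_derive_coord l j dG).
  by rewrite /= addrC mulrC; congr (_ + _); rewrite mulrC.
have dFG : derivable (fun y => F y *m G y) x v.
  by apply/derivable_mxP => i j; have [] := H i j.
split=> //; rewrite derive_mx //; apply/matrixP => i j; rewrite mxE.
by have [_ ->] := H i j.
Qed.

Lemma schwarz_smooth m n (O : set E) (f : E -> 'M[R]_(m, n)) x u v :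
  open O -> O x -> smooth_on O f -> 'D_v ('D_u f) x = 'D_u ('D_v f) x.
Proof.
move=> oO Ox sf; apply/matrixP => i j.
have nO : \forall y \near x, O y by exact: open_nbhs_nbhs.
have dd s y : O y -> differentiable (iter_derive s f) y by apply: sf.
apply: (@schwarz _ _ (fun y => f y i j) (fun y => 'D_u f y i j)
   (fun y => 'D_v f y i j) (fun y => 'D_v ('D_u f) y i j)
   (fun y => 'D_u ('D_v f) y i j) x u v).
- near=> y; apply/is_derive_coord/diff_derivable/(dd [::]); near: y; exact: nO.
- near=> y; apply/is_derive_coord/diff_derivable/(dd [::]); near: y; exact: nO.
- near=> y; apply/is_derive_coord/diff_derivable/(dd [:: u]).
  by near: y; exact: nO.
- near=> y; apply/is_derive_coord/diff_derivable/(dd [:: v]).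
  by near: y; exact: nO.
- exact/differentiable_continuous/differentiable_entry/(dd [:: v; u]).
- exact/differentiable_continuous/differentiable_entry/(dd [:: u; v]).
Unshelve. all: by end_near. Qed.

End MatrixCalculus.

(** * The torsion in one chart *)

Section TorsionInChart.
Context {R : realType} {n : nat} {M : manifold R n} (A : tensor11 M).
Context (c : chart R M n) (p : M) (cp : cdom c p).

Local Notation coords F := (F c \o cinv c).
Local Notation x0 := (cmap c p).

Context (dA : differentiable (coords A) x0).

Definition derive_tensor (u : 'cV[R]_n) : 'M[R]_n := 'D_u (coords A) x0.

Lemma differentiable_tapply (X : components) :
  differentiable (coords X) x0 -> differentiable (coords (tapply A X)) x0.
Proof. exact: differentiable_mulmx. Qed.

Lemma derive_tapply (X : components) u : differentiable (coords X) x0 ->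
  'D_u (coords (tapply A X)) x0 =
  derive_tensor u *m X c p + A c p *m 'D_u (coords X) x0.
Proof.
move=> dX; have dAu := diff_derivable (v := u) dA.
have [_ ->] := is_derive_mulmx dAu (diff_derivable dX).
by rewrite /= cmapK.
Qed.

(** From level 1 on the torsions depend on the fields only through their values
at the point: the Leibniz rule removes the derivatives of the fields at level 1,
and the recursion is then pointwise. *)
Lemma torsion_mxP m (X Y : components) :
  differentiable (coords X) x0 -> differentiable (coords Y) x0 ->
  torsion A m.+1 X Y c p = torsion_mx (A c p) derive_tensor m (X c p) *m Y c p
                         - torsion_mx (A c p) derive_tensor m (Y c p) *m X c p.
Proof.
elim: m X Y => [|m IH] X Y dX dY.
  by rewrite /= /lie_bracket !derive_tapply // nijenhuis_leibniz.
have dAX := differentiable_tapply dX; have dAY := differentiable_tapply dY.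
have torsionS U V : torsion A m.+2 U V c p =
    A c p *m (A c p *m torsion A m.+1 U V c p)
    + torsion A m.+1 (tapply A U) (tapply A V) c p
    - A c p *m (torsion A m.+1 U (tapply A V) c p
                + torsion A m.+1 (tapply A U) V c p) by [].
by rewrite torsionS !IH // torsion_mx_step.
Qed.

End TorsionInChart.

(** * Change of chart *)

Section ChartNeighbourhoods.
Context {R : realType} {n : nat} {M : topologicalType} (c : chart R M n).

Lemma near_chart (P : set M) p : cdom c p -> (\forall q \near p, P q) ->
  \forall y \near cmap c p, P (cinv c y).
Proof.
move=> cp nP; apply: (@cinv_continuous _ _ _ c) => /=; first by exists p.
by rewrite cmapK.
Qed.

Lemma near_image p : cdom c p -> \forall y \near cmap c p, (cmap c @` cdom c) y.
Proof.
by move=> cp; apply: open_nbhs_nbhs; split; [exact: cimg_open | exists p].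
Qed.

Lemma open_image (W : set M) : open W -> open (cmap c @` (cdom c `&` W)).
Proof.
move=> oW; rewrite openE => _ [p [cp Wp] <-]; rewrite /interior.
have nW : \forall y \near cmap c p, W (cinv c y).
  by apply: near_chart => //; exact: open_nbhs_nbhs.
near=> y; have [q cq qy] : (cmap c @` cdom c) y by near: y; exact: near_image.
exists q => //; split => //; rewrite -(cmapK cq) qy; near: y; exact: nW.
Unshelve. all: by end_near. Qed.
End ChartNeighbourhoods.

Section Tensoriality.
Context {R : realType} {n : nat} {M : manifold R n} (A : tensor11 M).
Context (c c' : chart R M n) (p : M).
Context (atlas_c : atlas M c) (atlas_c' : atlas M c').
Context (cp : cdom c p) (c'p : cdom c' p).

Local Notation phi := (transition c c').
Local Notation x0 := (cmap c p).
Local Notation O := (cmap c @` (cdom c `&` cdom c')).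

Definition jacobian_mx (y : 'cV[R]_n) : 'M[R]_n :=
  \matrix_(i, j) 'D_(delta_mx j 0) phi y i 0.

Lemma open_overlap : open O.
Proof. exact/open_image/cdom_open. Qed.

Lemma overlap_p : O x0.
Proof. by exists p. Qed.

Lemma near_overlap : \forall y \near x0, O y.
Proof.
by apply: open_nbhs_nbhs; split; [exact: open_overlap|exact: overlap_p].
Qed.

Lemma smooth_phi : smooth_on O phi.
Proof. by case: (atlas_compatible atlas_c atlas_c'). Qed.

Lemma diff_phiE y w : O y -> 'd phi y w = jacobian_mx y *m w.
Proof.
move=> Oy; have dphi : differentiable phi y := smooth_phi [::] Oy.
have -> : w = \sum_j w j 0 *: delta_mx j 0.
  by rewrite [LHS]matrix_sum_delta; apply: eq_bigr => j _; rewrite big_ord1.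
rewrite linear_sum mulmx_sumr; apply: eq_bigr => j _ /=.
rewrite linearZ /= -scalemxAr -colE -deriveE //; congr (_ *: _).
by apply/colP => i; rewrite !mxE.
Qed.

Lemma differentiable_jacobian_mx : differentiable jacobian_mx x0.
Proof.
apply: differentiable_mx => i j.
have -> : (fun y => jacobian_mx y i j) = (fun y => 'D_(delta_mx j 0) phi y i 0).
  by apply/funext => y; rewrite mxE.
apply: differentiable_entry.
exact: (smooth_phi [:: delta_mx j 0] overlap_p).
Qed.

Lemma derive_jacobian_mx u w :
  'D_u jacobian_mx x0 *m w = 'D_u ('D_w phi) x0.
Proof.
have dJ := diff_derivable (v := u) differentiable_jacobian_mx.
have [_ ] := is_derive_mulmx dJ (derivable_cst w x0 u).
rewrite derive_cst mulmx0 addr0 => <-; apply: near_eq_derive; near=> y.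
have Oy : O y by near: y; exact: near_overlap.
by rewrite -diff_phiE // deriveE //; exact: (smooth_phi [::] Oy).
Unshelve. all: by end_near. Qed.

(** Both sides are values of the second differential of the transition map, on
the pairs (u, w) and (w, u). *)
Lemma derive_jacobian_mx_sym u w :
  'D_u jacobian_mx x0 *m w = 'D_w jacobian_mx x0 *m u.
Proof.
transitivity ('D_u ('D_w phi) x0).
  exact: derive_jacobian_mx.
transitivity ('D_w ('D_u phi) x0).
  exact: (schwarz_smooth w u open_overlap overlap_p smooth_phi).
apply/esym.
exact: derive_jacobian_mx.
Qed.

(** What the torsion at [p] needs to know of a vector field on a neighbourhood
of [p]. Unlike [vfield], this is visibly inherited by [tapply A X], as needed in
an induction on the level of the torsion. *)
Record field_near (X : @components R n M) : Prop := FieldNear {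
  field_near_diff : differentiable (X c \o cinv c) x0;
  field_near_diff' : differentiable (X c' \o cinv c') (cmap c' p);
  field_near_change : \forall q \near p, X c' q = 'd phi (cmap c q) (X c q)
}.

Lemma near_dom : \forall q \near p, cdom c q /\ cdom c' q.
Proof.
by apply: filterI; apply: open_nbhs_nbhs; split=> //; exact: cdom_open.
Qed.

(** Differentiating the transformation law of Y along X: the second term is the
tensorial one, and the first is the value at (X, Y) of the second differential
of the transition map. *)
Lemma derive_change (X Y : components) : field_near X -> field_near Y ->
  'D_(X c' p) (Y c' \o cinv c') (cmap c' p) =
  'D_(X c p) jacobian_mx x0 *m Y c p
  + 'd phi x0 ('D_(X c p) (Y c \o cinv c) x0).
Proof.
case=> _ _ /nbhs_singleton ->; case=> dY dY' chY.
have Ox0 := overlap_p.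
have dphi : differentiable phi x0 := smooth_phi [::] Ox0.
have phix0 : phi x0 = cmap c' p by rewrite /transition /= cmapK.
rewrite -phix0 in dY' *.
transitivity ('D_(X c p) ((Y c' \o cinv c') \o phi) x0).
  rewrite !deriveE //; last exact: differentiable_comp.
  exact: esym (congr1 (fun g => g (X c p)) (diff_comp dphi dY')).
have dJ := diff_derivable (v := X c p) differentiable_jacobian_mx.
have [_ ] := is_derive_mulmx dJ (diff_derivable (v := X c p) dY).
rewrite -diff_phiE //= cmapK // => <-; apply: near_eq_derive.
have nY := near_chart cp (filterI near_dom chY).
near=> y.
have Oy : O y by near: y; exact: near_overlap.
have [[cy c'y] chy] : (cdom c (cinv c y) /\ cdom c' (cinv c y)) /\
    Y c' (cinv c y) = 'd phi (cmap c (cinv c y)) (Y c (cinv c y)).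
  by near: y; exact: nY.
have yK : cmap c (cinv c y) = y by have [q [cq _] <-] := Oy; rewrite cmapK.
by rewrite /= cmapK // chy yK diff_phiE.
Unshelve. all: by end_near. Qed.

(** The terms with the second differential cancel, by its symmetry. *)
Lemma lie_bracket_change (X Y : components) : field_near X -> field_near Y ->
  lie_bracket X Y c' p = 'd phi x0 (lie_bracket X Y c p).
Proof.
move=> fX fY; rewrite /lie_bracket !derive_change // linearB /=.
have cancel (a b s t : 'cV[R]_n) : a = b -> a + s - (b + t) = s - t.
  by move=> ->; rewrite opprD addrACA subrr add0r.
exact/cancel/derive_jacobian_mx_sym.
Qed.

Lemma tensor_diff (d : chart R M n) : atlas M d -> cdom d p ->
  differentiable (A d \o cinv d) (cmap d p).
Proof. by move=> ad dp; apply: (tensor11_smooth A ad [::]); exists p. Qed.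

Lemma field_near_tapply (X : components) :
  field_near X -> field_near (tapply A X).
Proof.
case=> dX dX' chX; split.
- exact: differentiable_mulmx (tensor_diff atlas_c cp) dX.
- exact: differentiable_mulmx (tensor_diff atlas_c' c'p) dX'.
near=> q; have [cq c'q] : cdom c q /\ cdom c' q by near: q; exact: near_dom.
rewrite /tapply -tensor11_change //; congr (_ *m _); near: q; exact: chX.
Unshelve. all: by end_near. Qed.

(** Torsions are built from the bracket and [A] by operations that commute with
the differential of the transition map, so vanishing in one chart is vanishing
in all. *)
Lemma torsion_change m (X Y : components) : field_near X -> field_near Y ->
  torsion A m X Y c' p = 'd phi x0 (torsion A m X Y c p).
Proof.
elim: m X Y => [|m IH] X Y fX fY; first exact: lie_bracket_change.
have fAX := field_near_tapply fX; have fAY := field_near_tapply fY.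
by rewrite /= !IH // -linearD /= !tensor11_change // -linearD -linearB.
Qed.

End Tensoriality.

(** * Vanishing on the kernels *)

Lemma iter_tapply (R : realType) n (M : manifold R n) (A : tensor11 M)
    k (X : components) c p :
  iter k (tapply A) X c p = A c p ^+ k *m X c p.
Proof.
elim: k => [|k IH] /=; first by rewrite expr0 mul1mx.
by rewrite /tapply IH exprS mulmxA mulmxE.
Qed.

Theorem proposition26 (R : realType) (n : nat) (M : manifold R n)
    (A : tensor11 M) (nilcA : nilcyclic A)
    (c : chart R M n) (atlas_c : atlas M c) (triA : triangular_in A c)
    (k : nat) (k_ge2 : (2 <= k)%N)
    (W : set M) (openW : open W) (X Y : vfield M W)
    (kerX : in_ker_pow A k W X) (kerY : in_ker_pow A k W Y) :
  forall p : M, W p -> cdom c p -> vanishes_at (torsion A k.-1 X Y) p.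
Proof.
move=> p Wp cp c' atlas_c' c'p.
have near_field (Z : vfield M W) : field_near c c' p Z.
  split.
  - by apply: (vfield_smooth Z atlas_c [::]); exists p.
  - by apply: (vfield_smooth Z atlas_c' [::]); exists p.
  near=> q; apply: vfield_change => //; near: q;
    by apply: open_nbhs_nbhs; split=> //; exact: cdom_open.
rewrite (torsion_change A atlas_c atlas_c' cp c'p) //.
suff -> : torsion A k.-1 X Y c p = 0 by rewrite linear0.
have dA := tensor_diff A atlas_c cp.
case: k k_ge2 kerX kerY => [|[|m]] // _ kerX kerY.
rewrite torsion_mxP //; [|exact: field_near_diff (near_field _)..].
have A1 : lowers 1 (A c p) by move=> i j; rewrite addn1; exact: triA.
have [_ An0] := nilcA c p atlas_c cp.
have flag (Z : vfield M W) : in_ker_pow A m.+2 W Z ->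
    in_flag m.+2 (vcomp Z c p).
  move=> kerZ; apply: ker_pow_in_flag A1 An0 _; rewrite -iter_tapply.
  exact: kerZ.
(* The entries of [A] on and below the diagonal vanish near the point, hence so
   do their derivatives. *)
have N1 u : lowers 1 (derive_tensor A c p u).
  move=> i j; rewrite addn1 ltnS => ji; rewrite /derive_tensor.
  have [_ <-] := is_derive_coord i j (diff_derivable (v := u) dA).
  rewrite -[RHS](derive_cst 0 (cmap c p) u); apply: near_eq_derive.
  near=> y; apply: triA => //.
  have [q cq <-] : (cmap c @` cdom c) y by near: y; exact: near_image.
  by rewrite cmapK.
have NZ a u : derive_tensor A c p (a *: u) = a *: derive_tensor A c p u.
  by rewrite /derive_tensor !deriveE // linearZ.
by rewrite (torsion_mx_sym A1 N1 NZ (flag X kerX) (flag Y kerY)) subrr.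
Unshelve. all: by end_near. Qed.
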